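(* Let $S$ be a nonabelian finite simple group, let $\Sigma$ be a nonempty subset of $S$, let $m$ be a positive integer, and let $\mathcal{M}$ be a nonempty set of maximal subgroups of $S$ such that the following conditions hold. (0) If $M \in \mathcal{M}$ then $M^{s} \in \mathcal{M}$ for every $s \in S$. (1) $\Sigma \cap M \neq \emptyset$ for every $M \in \mathcal{M}$. (2) $\Sigma \subseteq \bigcup_{M \in \mathcal{M}} M$. (3) $\Sigma \cap M_{1} \cap M_{2} = \emptyset$ for every pair of distinct subgroups $M_{1}, M_{2} \in \mathcal{M}$. (4) $\mathcal{M}$ contains at least two subgroups that are not conjugate in $S$. (5) $m \geq 2$ and $$\max \Big\{ (1+\alpha(m))|S|^{m/\ell},\ \max_{H < S,\ H \notin \mathcal{M}} |\Sigma \cap H|\,|H|^{m-1} \Big\} \leq \min \Big\{ \Big( \sum |\Sigma \cap M_{1}|\, |\Sigma \cap M_{2}| \Big) |S|^{m-2},\ \min_{M \in \mathcal{M}} |\Sigma \cap M|\,|M|^{m-1} \Big\},$$ where $\ell$ is the smallest prime divisor of $m$, $H$ ranges over the proper subgroups of $S$ not belonging to $\mathcal{M}$, and the sum is over all (ordered) pairs $(M_{1},M_{2}) \in \mathcal{M}^{2}$ with $M_{1}$ not conjugate to $M_{2}$ in $S$. Then $$\alpha(m) + \sum_{M \in \mathcal{M}} |S:M|^{m-1} \leq \sigma(S \wr C_{m}) \leq \alpha(m) + \min_{\mathcal{N}} \sum_{M \in \mathcal{N}} |S:M|^{m-1},$$ where the minimum is over all coverings $\mathcal{N}$ of $S$.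
   Context: For a non-cyclic finite group $X$, $\sigma(X)$ denotes the least number of proper subgroups of $X$ whose union is $X$. $\alpha(m)$ is the number of distinct prime divisors of the positive integer $m$. $C_m$ is the cyclic group of order $m$, and $S \wr C_m$ is the wreath product $S^m \rtimes C_m$ in which a generator of $C_m$ permutes the $m$ coordinates cyclically. $M^{s} = s^{-1}Ms$. A covering of $S$ is a set of proper subgroups of $S$ whose union is $S$. *)

(* Defs.v *)
From mathcomp Require Import all_boot all_fingroup all_solvable.

Set Implicit Arguments.
Unset Strict Implicit.
Unset Printing Implicit Defensive.

Local Open Scope group_scope.

(* The minimum of the F i over the i satisfying P. Starting the fold at the
   maximum of these values makes it the exact minimum whenever some i satisfies
   P; the value is 0 when there is no such i. *)
Definition min_over (I : finType) (P : pred I) (F : I -> nat) : nat :=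
  \big[minn/(\max_(i | P i) F i)]_(i | P i) F i.

Lemma min_over_attained (I : finType) (P : pred I) (F : I -> nat) (i : I) :
  P i -> exists2 j, P j & min_over P F = F j.
Proof.
move=> Pi; have [j0 Pj0 maxE] := eq_bigmax_cond F (introT card_gt0P (ex_intro _ i Pi)).
have {}maxE : \max_(i | P i) F i = F j0 by rewrite -maxE; apply: eq_bigl.
rewrite /min_over maxE.
elim/big_ind: _ => [|x y [jx Pjx ->] [jy Pjy ->]|j Pj].
- by exists j0.
- by case: leqP; [exists jx | exists jy].
- by exists j.
Qed.

Lemma min_over_le (I : finType) (P : pred I) (F : I -> nat) (i : I) :
  P i -> (min_over P F <= F i)%N.
Proof.
move=> Pi; rewrite /min_over; move: (\max_(j | P j) F j) => b; elim: index_enum (mem_index_enum i) => // j r IHr.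
rewrite in_cons big_cons => /predU1P[<- | /IHr le_r]; first by rewrite Pi geq_minl.
by case: ifP => // _; rewrite geq_min le_r orbT.
Qed.

Section Covering.

Variable gT : finGroupType.
Implicit Types (A : {set gT}) (C : {set {group gT}}).

Definition is_covering A C : bool :=
  [forall (H : {group gT} | H \in C), H \proper A] && (\bigcup_(H in C) H == A).

(* Meant for non-cyclic A: a cyclic group has no covering and gets 0. *)
Definition sigma A : nat :=
  min_over (is_covering A) (fun C : {set {group gT}} => #|C|).

End Covering.

Definition alpha (m : nat) : nat := size (primes m).

Section Wreath.

Variables (gT : finGroupType) (m : nat).

Definition rot_perm : 'S_m := perm (@ordS_inj m).

Lemma rot_permX k (i : 'I_m) : (rot_perm ^+ k) i = (i + k) %% m :> nat.
Proof.
elim: k => [|k IHk]; first by rewrite expg0 perm1 addn0 modn_small.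
by rewrite expgSr permM permE /= IHk -addn1 modnDml addn1 addnS.
Qed.

Lemma order_rot_perm : (0 < m)%N -> #[rot_perm] = m.
Proof.
move=> m_gt0; apply/eqP; rewrite eqn_dvd order_dvdn; apply/andP; split.
  apply/eqP/permP=> i; apply: val_inj.
  by rewrite /= rot_permX perm1 modnDr modn_small.
by rewrite /dvdn -(rot_permX _ (Ordinal m_gt0)) expg_order perm1.
Qed.

(* C_m, acting regularly on the coordinates. *)
Definition rot_group : {group 'S_m} := <[rot_perm]>.

Definition pow_type : finGroupType := {dffun forall i : 'I_m, gT}.

(* The inverse makes this a right action. *)
Definition coord_act (f : pow_type) (s : 'S_m) : pow_type :=
  [ffun i => f (s^-1 i)].

Lemma coord_act_is_action : is_action rot_group coord_act.
Proof.
split=> [s f g /ffunP eq_fg|f s t _ _].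
  by apply/ffunP=> i; have := eq_fg (s i); rewrite !ffunE permK.
by apply/ffunP=> i; rewrite !ffunE invMg permM.
Qed.

Canonical coord_action := Action coord_act_is_action.

Lemma coord_act_is_groupAction : is_groupAction [set: pow_type] coord_action.
Proof.
move=> s Ds; rewrite inE; apply/andP; split.
  by apply/subsetP=> f _; rewrite inE.
apply/morphicP=> f g _ _; rewrite !actpermE /=.
by apply/ffunP=> i; rewrite !ffunE.
Qed.

Canonical coord_groupAction := GroupAction coord_act_is_groupAction.

Definition wreath_type : finGroupType := sdprod_by coord_groupAction.

Definition wreath (S : {group gT}) : {group wreath_type} :=
  (sdpair1 coord_groupAction @* setXn (fun _ : 'I_m => S)
     <*> sdpair2 coord_groupAction @* rot_group)%G.

Lemma wreath_sdprod (S : {group gT}) :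
  sdpair1 coord_groupAction @* setXn (fun _ : 'I_m => S)
    ><| sdpair2 coord_groupAction @* rot_group = wreath S.
Proof.
pose B := (sdpair1 coord_groupAction @* setXn (fun _ : 'I_m => S))%G.
pose C := (sdpair2 coord_groupAction @* rot_group)%G.
have nBC : C \subset 'N(B).
  rewrite -actsEsd ?subsetT //; apply/subsetP=> s Ds; rewrite !inE Ds /=.
  apply/subsetP=> f; rewrite !inE => /forallP Sf.
  by apply/forallP=> i; rewrite ffunE; apply: Sf.
have tiBC : B :&: C = 1.
  apply/trivgP; rewrite -(im_sdpair_TI coord_groupAction) setSI //.
  exact/morphimS/subsetT.
by rewrite -[LHS]/(B ><| C) sdprodE // -norm_joinEr.
Qed.

End Wreath.

(* Main.v *)
Require Import Defs.
From mathcomp Require Import all_boot all_fingroup all_solvable.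
From mathcomp Require Import all_order all_algebra.
From mathcomp Require Import ring lra zify.

(** Write B for the base S^m of G = S wr C_m, g for the generator of C_m, and
    n for the sum of the |S : M|^(m-1) over the given set of maximal subgroups.

    Upper bound.  For a prime r dividing m, the preimage of <g^r> is a proper
    subgroup, and these alpha(m) subgroups contain every element whose image in
    C_m is not a generator.  An element x whose image is a generator permutes
    the coordinates in one cycle, and the first coordinate y of x^m lies in some
    member M of a given covering of S.  Following the cycle from coordinate 0,
    the coset M of S is carried to one coset of M in each coordinate, and
    consistently so because y is in M: x fixes a tuple of right cosets of M that
    starts with M itself ([tuple_stabilised]).  There are |S : M|^(m-1) such
    tuples, and their stabilisers are proper.

    Lower bound.  Call a member K of a covering of G full when KB = G.  Only
    full members meet the coset Bg.  A member that meets Bg^r, for a prime r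
    dividing m, is full or satisfies KB = B<g^r>; so it belongs to one prime r
    at most.  If every r has such a nonfull member, there are alpha(m) nonfull
    members, and it is enough to find n full ones.  Otherwise the full members
    alone cover Bg^r for some r, and it is enough to see that this takes at
    least n + alpha(m) of them.

    For j dividing m, Bg^j is put in bijection with S^m by the map [chart] that
    replaces coordinate i < j of x by coordinate i of x^(m/j), which is the
    product of the coordinates of x along a cycle of g^j.  Let K be full, and
    let H be the projection of K :&: B to coordinate 0.  The other projections
    are conjugate to H.  If H < S, the part of K in Bg^j becomes a subset of a
    box whose sides are cosets of conjugates of H, and are these conjugates
    themselves in the first j coordinates ([chart_in_coset_box]).  If H = S,
    then K :&: B is subdirect in B but is not B, so it is contained in a product
    of diagonal subgroups and has order at most |S|^(m/l), where l is the least
    prime divisor of m ([card_base_diagonal]).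

    Give a point of S^m the weight 1 / (|Sigma :&: M| |M|^(m-1)) when its
    coordinate 0 is in Sigma :&: M, and 0 when it is outside Sigma.  Since the
    sets Sigma :&: M are disjoint, the total weight is n ([wt_total]), and the
    inequality between the sizes says that every full member has weight at most
    1.  The case j = 1 yields at least n full members.

    Now let j = r be prime.  The direction of coordinate 1 is also one in which
    the boxes have subgroups of S as sides.  On a line in this direction S is
    covered by proper subgroups and by few exceptional points, and subgroups
    overlap: if w of them cover S, their orders add up to at least
    |S| (1 + 1/(w+1)) ([cohn_covering]).  So the total weight of the full
    members exceeds n by the average of 1/(w+1), times n.  A box meets at most
    the fraction 2^-(m-2) of the lines, hence w is small on average, and the
    excess is at least 2^(m-1)/5 > alpha(m) - 1 ([lines_bound],
    [tangent_optimum]). *)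

Set Implicit Arguments.
Unset Strict Implicit.
Unset Printing Implicit Defensive.
Import Order.TTheory GRing.Theory Num.Theory.
Local Open Scope group_scope.

(** * Coverings of a group by subgroups and exceptional points *)

Lemma card_setU_le (T : finType) (A B : {set T}) : (#|A :|: B| <= #|A| + #|B|)%N.
Proof. by rewrite cardsU leq_subr. Qed.

Lemma card_bigcup_le (I T : finType) (Q : {set I}) (B : I -> {set T}) :
  (#|\bigcup_(k in Q) B k| <= \sum_(k in Q) #|B k|)%N.
Proof.
elim/big_ind2: _ => [|n1 A1 n2 A2 le1 le2|//]; first by rewrite cards0.
exact: leq_trans (card_setU_le _ _) (leq_add le1 le2).
Qed.

(** Proper subgroups that cover S up to the points of D overlap.  Let H be the
    largest of them, of order h.  Any other one, of order k, meets H in at least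
    k h / |S| points, so it contributes at most k (1 - h / |S|) points outside H.
    As h / |S| <= 1/2, the others together with 2 |D| still amount to |S|, and
    the sum on the right is at least |S| + h.  It is also at least |S| + |D|, and
    the larger of h and |D| is at least |S| / (w + 1), where w is the number of
    subgroups.  When w = 0 this degenerates to |S| <= |D|. *)
Lemma cohn_covering (I : finType) (gT : finGroupType) (S : {group gT})
    (Q : {set I}) (H : I -> {group gT}) (D : {set gT}) :
    (forall k, k \in Q -> H k \proper S) ->
    S \subset (\bigcup_(k in Q) H k) :|: D ->
  (#|Q|.+2 * #|S| <= #|Q|.+1 * (\sum_(k in Q) #|H k| + 2 * #|D|))%N.
Proof.
move=> prH covS.
have [Q0|[k0 Qk0]] := set_0Vmem Q.
  rewrite Q0 !big_set0 set0U in covS *.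
  by rewrite cards0 mul1n add0n leq_mul // subset_leq_card.
case: (@arg_maxnP I k0 (mem Q) (fun k => #|H k|) Qk0) => k1.
rewrite -[mem Q k1]/(k1 \in Q) => Qk1 maxH.
pose R := (\sum_(k in Q :\ k1) #|H k|)%N.
have sumE : (\sum_(k in Q) #|H k| = #|H k1| + R)%N.
  rewrite (bigD1 k1) //=; congr (_ + _)%N; apply: eq_bigl => k.
  by rewrite !inE andbC.
have sH1S : H k1 \subset S by have/andP[] := prH k1 Qk1.
have half : (2 * #|H k1| <= #|S|)%N.
  rewrite -(Lagrange sH1S) mulnC leq_mul2l; apply/orP; right.
  by rewrite indexg_gt1; have/andP[] := prH k1 Qk1.
have cov1 : (#|S| <= #|H k1| + R + #|D|)%N.
  rewrite -sumE; apply: leq_trans (subset_leq_card covS) _.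
  by apply: leq_trans (card_setU_le _ _) _; rewrite leq_add2r card_bigcup_le.
have avg : (R <= #|Q|.-1 * #|H k1|)%N.
  have -> : #|Q|.-1 = #|Q :\ k1| by rewrite (cardsD1 k1 Q) Qk1.
  rewrite /R -sum_nat_const; apply: leq_sum => k /setD1P[_ Qk]; exact: maxH.
have cov2 : (#|S| <= #|H k1| + \sum_(k in Q :\ k1) #|H k :\: H k1| + #|D|)%N.
  have sub: S \subset H k1 :|: \bigcup_(k in Q :\ k1) (H k :\: H k1) :|: D.
    apply/subsetP=> x /(subsetP covS); rewrite !inE => /orP[/bigcupP[k Qk Hkx]|->].
      case: (boolP (x \in H k1)) => //= nH1x; apply/orP; left.
      apply/bigcupP; exists k; last by rewrite inE nH1x.
      by rewrite !inE Qk andbT; apply: contraNneq nH1x => <-.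
    by rewrite orbT.
  apply: leq_trans (subset_leq_card sub) (leq_trans (card_setU_le _ _) _).
  rewrite leq_add2r (leq_trans (card_setU_le _ _)) // leq_add2l.
  exact: card_bigcup_le.
have diff k : k \in Q ->
    (#|S| * #|H k :\: H k1| + #|H k| * #|H k1| <= #|S| * #|H k|)%N.
  move=> Qk; rewrite -[in leqRHS](cardsID (H k1) (H k)) mulnDr addnC leq_add2r.
  rewrite mul_cardG leq_mul2r subset_leq_card ?orbT // mul_subG //.
  by have/andP[] := prH k Qk.
have sumdiff :
    (#|S| * \sum_(k in Q :\ k1) #|H k :\: H k1| + R * #|H k1| <= #|S| * R)%N.
  rewrite /R big_distrr big_distrl big_distrr -big_split /=.
  by apply: leq_sum => k /setD1P[_ Qk]; apply: diff.
have Q_gt0 : (0 < #|Q|)%N by apply/card_gt0P; exists k1.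
have S_gt0 := cardG_gt0 S.
rewrite sumE; move: (\sum_(k in Q :\ k1) _)%N cov2 sumdiff => R' cov2 sumdiff.
move: #|Q| Q_gt0 avg => q; move: R cov1 sumdiff {sumE maxH diff prH covS sH1S}.
move: #|S| #|H k1| #|D| half S_gt0 cov2 => s h d half S_gt0 cov2.
move=> R cov1 sumdiff q_gt0 avg.
(* (s - h) (s - R) <= s d and 2 h <= s. *)
have key : (s <= R + 2 * d)%N by nia.
have [q' Eq] : exists q', q = q'.+1 by exists q.-1; rewrite prednK.
subst q; rewrite /= in avg; nia.
Qed.

(** * Weighted counting of boxes and lines *)

Section Boxes.

Variables (m : nat) (T : finType).

(** A product of subsets, as a set of finite functions; unlike [setXn] it has no
    group structure, since its sides need not be groups. *)
Definition boxset (A : 'I_m -> {set T}) : {set {ffun 'I_m -> T}} :=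
  [set u : {ffun 'I_m -> T} | [forall i, u i \in A i]].

Lemma boxsetP (A : 'I_m -> {set T}) (u : {ffun 'I_m -> T}) :
  reflect (forall i, u i \in A i) (u \in boxset A).
Proof. by rewrite inE; apply: forallP. Qed.

Lemma card_boxset (A : 'I_m -> {set T}) : #|boxset A| = (\prod_i #|A i|)%N.
Proof.
rewrite (eq_card (B := family (fun i => mem (A i)))) => [|u].
  by rewrite card_family foldrE big_map big_enum.
by apply/boxsetP/familyP.
Qed.

End Boxes.

Lemma prod_card_const (I T : finType) (A : I -> {set T}) h (P : pred I) :
  (forall i, P i -> #|A i| = h) -> (\prod_(i | P i) #|A i| = h ^ #|P|)%N.
Proof. by move=> Ah; rewrite (eq_bigr (fun _ => h)) // prod_nat_const. Qed.

Lemma sum_le_cover (I T : finType) (F : T -> rat) (A : {set T})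
    (Q : {set I}) (B : I -> {set T}) :
    (forall x, 0 <= F x)%R -> A \subset \bigcup_(k in Q) B k ->
  (\sum_(x in A) F x <= \sum_(k in Q) \sum_(x in B k) F x)%R.
Proof.
move=> F_ge0 covA; rewrite (exchange_big_dep predT) //=.
rewrite big_mkcond; apply: ler_sum => x _; case: ifP => [Ax|_]; last exact: sumr_ge0.
have /bigcupP[k Qk Bx] := subsetP covA x Ax.
by rewrite (bigD1 k) ?Qk //= lerDl sumr_ge0.
Qed.

Section WeightedCount.

Variables (m : nat) (gT : finGroupType) (S : {group gT}) (v : gT -> rat).
Hypothesis v_ge0 : forall y, (0 <= v y)%R.
Local Notation X := {ffun 'I_m -> gT}.
Variable o : 'I_m.

Definition wt (A : {set gT}) : rat := (\sum_(y in A) v y)%R.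

Lemma wt_boxset (A : 'I_m -> {set gT}) :
  (\sum_(u in boxset A) v (u o) = wt (A o) * (\prod_(i | i != o) #|A i|)%:R)%R.
Proof.
pose F i y : rat := if i == o then v y else 1%R.
have E (u : X) : v (u o) = (\prod_i F i (u i))%R.
  by rewrite (bigD1 o) //= {1}/F eqxx big1 ?mulr1 // /F => i /negPf->.
rewrite (eq_bigr _ (fun u _ => E u)).
transitivity (\prod_i \sum_(y in A i) F i y)%R.
  rewrite bigA_distr_big_dep; apply: eq_bigl => u; rewrite inE.
  by apply/forallP/familyP => Au i; have := Au i.
rewrite (bigD1 o) //= natr_prod; congr (_ * _)%R.
  by apply: eq_bigr => y _; rewrite /F eqxx.
apply: eq_bigr => i /negPf ne_io; rewrite -sum1_card natr_sum.
by apply: eq_bigr => y _; rewrite /F ne_io.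
Qed.

Lemma wt_mono (A B : {set gT}) : A \subset B -> (wt A <= wt B)%R.
Proof.
move=> /setIidPr sAB; rewrite /wt [leRHS](big_setID A) /= sAB lerDl.
by apply: sumr_ge0 => y _.
Qed.

Lemma wt_boxset_const (A : 'I_m -> {set gT}) h : (forall i, #|A i| = h) ->
  (\sum_(u in boxset A) v (u o) = wt (A o) * (h ^ m.-1)%:R)%R.
Proof.
move=> Ah; rewrite wt_boxset (prod_card_const (h := h)) //.
by rewrite -[m in m.-1]card_ord -(cardC1 o).
Qed.

(** A union bound: sets of weight at most 1 that cover S^m are at least as many as
    the total weight of S^m, where a point is weighted by its coordinate o. *)
Lemma covering_weight_le (I : finType) (Q : {set I}) (E : I -> {set X}) :
    boxset (fun=> S) \subset \bigcup_(k in Q) E k ->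
    (forall k, k \in Q -> \sum_(u in E k) v (u o) <= 1)%R ->
  (wt S * (#|S| ^ m.-1)%:R <= #|Q|%:R)%R.
Proof.
move=> covS le1; rewrite -(wt_boxset_const (A := fun=> S)) //.
apply: le_trans (sum_le_cover _ covS) _ => [u|]; first exact: v_ge0.
by rewrite -sum1_card natr_sum; apply: ler_sum.
Qed.

(** Here S^m is covered by boxes, indexed by Q, and by exceptional sets, indexed
    by D.  A line is a set of points that differ only in coordinate o1, and it is
    represented by its point with value 1 there.  A box meets a line in all of
    its side H k or not at all. *)
Section Lines.

Variable o1 : 'I_m.
Hypotheses (ne_o1 : o1 != o) (m_ge2 : (2 <= m)%N).

Let upd (f : X) x : X := [ffun i => if i == o1 then x else f i].
Let L := boxset (fun i => if i == o1 then [set 1] else gval S).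

Lemma updE f x : (upd f x o1 = x) * (forall i, i != o1 -> upd f x i = f i).
Proof. by rewrite !ffunE eqxx; split=> // i /negPf ne; rewrite ffunE ne. Qed.

Lemma upd_id f x : f \in L -> upd (upd f x) 1 = f.
Proof.
move=> /boxsetP Lf; apply/ffunP=> i; rewrite !ffunE.
by case: eqP => // ->; have := Lf o1; rewrite eqxx => /set1P->.
Qed.

Lemma upd_inj f : injective (upd f).
Proof. by move=> x y eq_xy; rewrite -(updE f x).1 eq_xy updE. Qed.

Lemma card_others2 : #|[pred i | (i != o) && (i != o1)]| = m.-2.
Proof.
have := cardC1 o; rewrite card_ord => <- /=.
rewrite (cardD1 o1 (predC1 o)) inE /= ne_o1 add1n /=.
by apply: eq_card => i; rewrite !inE andbC.
Qed.

Lemma wt_lines (A : 'I_m -> {set gT}) h :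
    (forall i, i != o -> i != o1 -> #|A i| = h) ->
  (\sum_(f in boxset (fun i => if i == o1 then [set 1%g] else A i)) v (f o)
     = wt (A o) * (h ^ m.-2)%:R)%R.
Proof.
move=> Ah; rewrite wt_boxset eq_sym (negPf ne_o1); congr (_ * _%:R)%R.
rewrite (bigD1 o1) //= eqxx cards1 mul1n -card_others2.
rewrite -(prod_card_const (A := A)) => [|i /andP[]//]; last exact: Ah.
by apply: eq_bigr => i /andP[_ /negPf->].
Qed.

Variables (I : finType) (Q D : {set I}) (U : I -> 'I_m -> {set gT}).
Variables (H : I -> {group gT}) (E : I -> {set X}) (c : rat).
Local Notation n := (wt S * (#|S| ^ m.-1)%:R)%R.

Hypothesis cov : boxset (fun=> S) \subset
  (\bigcup_(k in Q) boxset (U k)) :|: \bigcup_(k in D) E k.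
Hypothesis prH : forall k, k \in Q -> H k \proper S.
Hypothesis U1 : forall k, k \in Q -> U k o1 = H k.
Hypothesis U0 : forall k, k \in Q -> U k o \subset S.
Hypothesis cardU : forall k i, k \in Q -> #|U k i| = #|H k|.
Hypothesis wtU : forall k, k \in Q -> (wt (U k o) * (#|H k| ^ m.-1)%:R <= 1)%R.
Hypothesis v_le : forall y, (v y <= c)%R.
Hypothesis wtE : forall k, k \in D -> (2%:R * c * #|E k|%:R <= 1)%R.

Let meet (f : X) := [set k in Q | [forall i, (i != o1) ==> (f i \in U k i)]].
Let diag (f : X) := [set u in \bigcup_(k in D) E k | upd u 1 == f].

(** The boxes that meet a line cut it in the subgroups H k, because o1 is a
    coordinate in which the sides are subgroups.  This is where a covering of a
    coset other than the generating ones has to overlap. *)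
Lemma line_cohn f : f \in L ->
  (#|meet f|.+2 * #|S| <=
     #|meet f|.+1 * (\sum_(k in meet f) #|H k| + 2 * #|diag f|))%N.
Proof.
move=> Lf; have Sf i : i != o1 -> f i \in S.
  by move=> ne; have /boxsetP/(_ i) := Lf; rewrite (negPf ne).
pose Df := [set x in S | upd f x \in \bigcup_(k in D) E k].
have leD : (#|Df| <= #|diag f|)%N.
  rewrite -(card_imset _ (@upd_inj f)); apply/subset_leq_card/subsetP=> u.
  by case/imsetP=> x /setIdP[_ Ex] ->; rewrite inE Ex upd_id //=.
apply: leq_trans (leq_mul (leqnn _) (leq_add (leqnn _) (leq_mul (leqnn 2) leD))).
apply: cohn_covering => [k|]; first by rewrite inE => /andP[/prH].
apply/subsetP=> x Sx; have : upd f x \in boxset (fun=> S).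
  by apply/boxsetP=> i; rewrite ffunE; case: eqP => // /eqP/Sf.
move=> /(subsetP cov); rewrite inE => /orP[/bigcupP[k Qk /boxsetP Uk]|Ex].
  rewrite inE; apply/orP; left; apply/bigcupP; exists k.
    rewrite inE Qk; apply/forallP=> i; apply/implyP=> ne.
    by have := Uk i; rewrite updE.
  by have := Uk o1; rewrite updE U1.
by rewrite inE [x \in Df]inE Sx Ex orbT.
Qed.

(** The factor 1 + 1/(w+1) of [line_cohn] is replaced by a tangent of this convex
    function of w, which is affine in w and so can be summed over the lines:
    1/(w+1) >= 2 lam - lam^2 (w+1), as w + 1 times the difference is a square. *)
Lemma line_ineq (lam : rat) f : f \in L ->
  (#|S|%:R * (1 + 2%:R * lam - lam ^+ 2 - lam ^+ 2 * #|meet f|%:R) <=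
     \sum_(k in meet f) #|H k|%:R + 2%:R * #|diag f|%:R)%R.
Proof.
move=> /line_cohn; rewrite -(ler_nat rat) !natrM natrD natr_sum natrM.
set T := (_ + _ * #|diag f|%:R)%R; set q := #|meet f|.
have -> : (q.+2%:R = q%:R + 2%:R :> rat)%R by rewrite -natrD addn2.
have -> : (q.+1%:R = q%:R + 1 :> rat)%R by rewrite natr1.
move: q%:R%R (ler0n rat q) => w w_ge0.
have s_ge0 := ler0n rat #|S|; move: #|S|%:R%R s_ge0 => s s_ge0 le_T.
have w1 : (0 < w + 1)%R by rewrite ltr_wpDl.
rewrite -(ler_pM2l w1); apply: le_trans le_T.
rewrite -subr_ge0.
suff -> : ((w + 2%:R) * s - (w + 1) * (s * (1 + 2%:R * lam - lam ^+ 2 - lam ^+ 2 * w))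
  = s * (1 - lam * (w + 1)) ^+ 2)%R by rewrite mulr_ge0 // sqr_ge0.
ring.
Qed.

(** A box meets as many lines as the product of its sides other than o1 has
    points; exchanging the two sums counts them. *)
Lemma sum_meeting (F : I -> rat) :
  (forall k, k \in Q -> 0 <= F k)%R ->
  (\sum_(f in L) v (f o) * (\sum_(k in meet f) F k) <=
     \sum_(k in Q) F k * (wt (U k o) * (#|H k| ^ m.-2)%:R))%R.
Proof.
move=> F_ge0; under eq_bigr do rewrite mulr_sumr.
rewrite (exchange_big_dep (mem Q)) /=; last by move=> f k _; rewrite inE => /andP[].
apply: ler_sum => k Qk; rewrite -mulr_suml mulrC; apply: ler_wpM2l; first exact: F_ge0.
rewrite -(wt_lines (A := U k)) => [|i _ _]; last exact: cardU.
rewrite big_mkcond [leRHS]big_mkcond; apply: ler_sum => f _.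
case: ifP => [/andP[Lf]|_]; last by case: ifP.
rewrite inE Qk => /forallP Uf; rewrite ifT //; apply/boxsetP=> i.
case: (i =P o1) => [->|/eqP ne]; last exact: (implyP (Uf i)).
by have /boxsetP/(_ o1) := Lf; rewrite eqxx.
Qed.

(** Each exceptional point is on one line only, and wtE keeps the factor 2 of
    [line_cohn] harmless. *)
Lemma sum_diag :
  (\sum_(f in L) v (f o) * (2%:R * #|diag f|%:R) <= #|D|%:R)%R.
Proof.
apply: (@le_trans _ _ (\sum_(k in D) 2%:R * c * #|E k|%:R)%R); last first.
  by rewrite -[leRHS]sumr_const; apply: ler_sum.
rewrite -mulr_sumr -natr_sum.
have c_ge0 : (0 <= c)%R by apply: le_trans (v_ge0 1) (v_le 1).
apply: (@le_trans _ _ (2%:R * c * (\sum_f #|diag f|)%:R)%R); last first.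
  rewrite ler_wpM2l ?mulr_ge0 // ler_nat; apply: leq_trans (card_bigcup_le _ _).
  rewrite -[leqRHS]sum1_card [leqRHS](partition_big (upd^~ 1) predT) //=.
  by apply: leq_sum => f _; rewrite -sum1_card; apply/eq_leq/eq_bigl=> u; rewrite inE.
rewrite natr_sum mulr_sumr big_mkcond; apply: ler_sum => f _.
case: ifP => _; last by rewrite !mulr_ge0.
by rewrite mulrCA -mulrA ler_wpM2l // ler_wpM2r.
Qed.

(** The sum of [line_ineq] over all lines.  The number of boxes meeting a line is
    small on average: a side of order at most |S| / 2 in each of the m - 2 other
    coordinates leaves the fraction 2^-(m-2) of the lines. *)
Lemma lines_bound (lam : rat) :
  (n * (1 + 2%:R * lam - lam ^+ 2) - lam ^+ 2 * n * #|Q|%:R / (2 ^ m.-2)%:R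
     <= #|Q|%:R + #|D|%:R)%R.
Proof.
have E1 : (\sum_(f in L) v (f o) * (\sum_(k in meet f) #|H k|%:R) <= #|Q|%:R)%R.
  apply: le_trans (sum_meeting _) _ => //; rewrite -[leRHS]sumr_const.
  apply: ler_sum => k Qk; rewrite mulrCA -natrM -expnS prednK; first exact: wtU.
  by rewrite -ltnS prednK // ltnW.
have E2 : (\sum_(f in L) v (f o) * #|meet f|%:R
           <= #|Q|%:R * (wt S * (#|S| ^ m.-2)%:R) / (2 ^ m.-2)%:R)%R.
  under eq_bigr do rewrite -sum1_card natr_sum.
  apply: le_trans (sum_meeting _) _ => //.
  rewrite -mulrA -[#|Q|%:R%R]sumr_const mulr_suml; apply: ler_sum => k Qk.
  rewrite !mul1r -mulrA; apply: ler_pM => //; first exact: sumr_ge0.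
    by apply: wt_mono; apply: U0.
  rewrite ler_pdivlMr ?ltr0n ?expn_gt0 // -natrM ler_nat -expnMn.
  have half : (#|H k| * 2 <= #|S|)%N.
    have /andP[sHS nSH] := prH Qk.
    by rewrite -(Lagrange sHS) leq_mul2l indexg_gt1 nSH orbT.
  by case: (m.-2) => // e; rewrite leq_exp2r.
have E3 : (\sum_(f in L) v (f o) = wt S * (#|S| ^ m.-2)%:R)%R by apply: wt_lines.
have le1 : (\sum_(f in L) v (f o) *
      (#|S|%:R * (1 + 2%:R * lam - lam ^+ 2 - lam ^+ 2 * #|meet f|%:R))
    <= \sum_(f in L) v (f o) * (\sum_(k in meet f) #|H k|%:R + 2%:R * #|diag f|%:R))%R.
  by apply: ler_sum => f Lf; apply/ler_wpM2l/line_ineq.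
set a := (1 + 2%:R * lam - lam ^+ 2)%R.
have {le1} : (#|S|%:R * a * (\sum_(f in L) v (f o))
    - #|S|%:R * lam ^+ 2 * (\sum_(f in L) v (f o) * #|meet f|%:R)
      <= #|Q|%:R + #|D|%:R)%R.
  apply: le_trans (lerD E1 sum_diag); rewrite -big_split /= !mulr_sumr -sumrB.
  under [leRHS]eq_bigr do rewrite -mulrDr.
  apply: le_trans le1; rewrite le_eqVlt; apply/orP; left; apply/eqP.
  by apply: eq_bigr => f _; rewrite /a; ring.
apply: le_trans; rewrite E3.
have Es : ((#|S| ^ m.-1)%:R = #|S|%:R * (#|S| ^ m.-2)%:R :> rat)%R.
  by rewrite -natrM -expnS prednK // -ltnS prednK // ltnW.
rewrite Es; apply: lerB; first by rewrite le_eqVlt; apply/orP; left; apply/eqP; ring.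
have /(ler_wpM2l (mulr_ge0 (ler0n rat #|S|) (sqr_ge0 lam))) := E2.
move/le_trans; apply; rewrite le_eqVlt; apply/orP; left; apply/eqP; ring.
Qed.

End Lines.
End WeightedCount.

(** The choice lam = t / (5 n) in [lines_bound], with t = 2^(m-1): it bounds the
    average of w + 1 by 5 n / t, using t <= n and q <= 2 n. *)
Lemma tangent_optimum (n q d t : rat) : (0 < t -> t <= n -> q <= 2%:R * n ->
    (forall lam, n * (1 + 2%:R * lam - lam ^+ 2)
                   - lam ^+ 2 * n * q / (t / 2%:R) <= q + d) ->
  n + t / 5%:R <= q + d)%R.
Proof.
move=> t_gt0 le_tn le_q /(_ (t / (5%:R * n))%R); apply: le_trans.
have n_gt0 : (0 < n)%R by lra.
set lam := (t / (5%:R * n))%R.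
have En : (lam * (5%:R * n) = t)%R.
  by rewrite /lam; field; rewrite lt0r_neq0.
have lam_gt0 : (0 < lam)%R by rewrite divr_gt0 ?mulr_gt0.
have lam1 : (lam <= 1 / 5%:R)%R by rewrite ler_pdivrMr ?mulr_gt0 //; lra.
have le2 : (lam ^+ 2 * n * q / (t / 2%:R) <= lam ^+ 2 * n * (2%:R * n) / (t / 2%:R))%R.
  rewrite ler_wpM2r ?invr_ge0 ?divr_ge0 ?(ltW t_gt0) // ler_wpM2l //.
  by rewrite mulr_ge0 ?sqr_ge0 // ltW.
have E2 : (lam ^+ 2 * n * (2%:R * n) / (t / 2%:R) = 4%:R / 5%:R * (lam * n))%R.
  by rewrite -{1}En; field; rewrite !lt0r_neq0.
have le3 : (lam ^+ 2 * n <= 1 / 5%:R * (lam * n))%R.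
  by rewrite expr2 -mulrA ler_wpM2r // mulr_ge0 // ltW.
have Et : (t / 5%:R = lam * n)%R by rewrite -En; field.
rewrite Et; move: le2; rewrite E2 => le2.
have -> : (n * (1 + 2%:R * lam - lam ^+ 2)
           = n + 2%:R * (lam * n) - lam ^+ 2 * n)%R by ring.
by lra.
Qed.

(** * Coordinates in the wreath product *)

Section Coordinates.

Variables (gT : finGroupType) (m : nat).
Implicit Types (g h : wreath_type gT m) (S : {group gT}).

(** An element of the wreath product is a permutation of the coordinates followed
    by an element of the base; [top] and [bcoord] are the two components. *)
Definition top g : 'S_m := (pair_of_sd g).1.
Definition bcoord g (i : 'I_m) : gT := (pair_of_sd g).2 i.

Lemma wreath_ext g h : top g = top h -> bcoord g =1 bcoord h -> g = h.
Proof.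
move=> eq_top eq_co; apply: val_inj.
by apply: injective_projections; [apply: eq_top | apply/ffunP].
Qed.

Lemma topM g h : top (g * h) = top g * top h. Proof. by []. Qed.

Lemma bcoordM g h i : bcoord (g * h) i = bcoord g ((top h)^-1 i) * bcoord h i.
Proof. by rewrite /bcoord /= !ffunE. Qed.

Lemma top1 : top 1 = 1. Proof. by []. Qed.

Lemma bcoord1 i : bcoord 1 i = 1. Proof. by rewrite /bcoord /= ffunE. Qed.

Lemma topX g n : top (g ^+ n) = top g ^+ n.
Proof. by elim: n => // n IHn; rewrite !expgS topM IHn. Qed.

Lemma topV g : top g^-1 = (top g)^-1.
Proof. by apply/eqP; rewrite eq_sym eq_invg_mul -topM mulgV. Qed.

Lemma bcoordXS g n i :
  bcoord (g ^+ n.+1) i = bcoord (g ^+ n) ((top g)^-1 i) * bcoord g i.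
Proof. by rewrite expgSr bcoordM. Qed.

Lemma top_rot g : top g \in Defs.rot_group m.
Proof. by rewrite /top; case: g => [[a x] /= /setXP[]]. Qed.

Lemma top_rotX g : exists k, top g = rot_perm m ^+ k.
Proof. by have /cycleP[k ->] := top_rot g; exists k. Qed.

Lemma rot_perm_expm : 0 < m -> rot_perm m ^+ m = 1.
Proof. by move=> m_gt0; rewrite -[X in _ ^+ X](order_rot_perm m_gt0) expg_order. Qed.

Definition wreath_elt (x : {ffun 'I_m -> gT}) (k : nat) : wreath_type gT m :=
  sdpair2 (coord_groupAction gT m) (rot_perm m ^+ k)
    * sdpair1 (coord_groupAction gT m) [ffun i => x i].

Lemma top_elt x k : top (wreath_elt x k) = rot_perm m ^+ k.
Proof.
rewrite /top /= /sdpair1 /sdpair2 !val_insubd !inE !group1 mem_cycle /=.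
by rewrite mulg1.
Qed.

Lemma bcoord_elt x k i : bcoord (wreath_elt x k) i = x i.
Proof.
rewrite /bcoord /= /sdpair1 /sdpair2 !val_insubd !inE !group1 mem_cycle /=.
by rewrite !ffunE /= mul1g.
Qed.

Lemma mem_wreath S g : (g \in wreath m S) = [forall i, bcoord g i \in S].
Proof.
apply/idP/forallP; last first.
  move=> Sg; rewrite [g]sdpairE groupM // mem_gen // inE; apply/orP; [right | left].
    by rewrite mem_morphim ?top_rot.
  by rewrite mem_morphim ?inE //; apply/forallP.
rewrite -(sdprodW (wreath_sdprod m S)) => /mulsgP[u v].
move=> /morphimP[x _ Sx ->{u}] /morphimP[a Da _ ->{v}] -> i.
move: Sx; rewrite inE => /forallP Sx.
rewrite bcoordM /bcoord /top /= /sdpair1 /sdpair2 !val_insubd !inE !group1 Da /=.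
by rewrite !ffunE mulg1 Sx.
Qed.

Lemma bcoordX_eq g h n i : top g = top h ->
    (forall e, e < n ->
      bcoord g (((top g)^-1 ^+ e) i) = bcoord h (((top g)^-1 ^+ e) i)) ->
  bcoord (g ^+ n) i = bcoord (h ^+ n) i.
Proof.
move=> eq_t; elim: n i => [|n IHn] i eq_co; first by rewrite !expg0 !bcoord1.
rewrite !bcoordXS -eq_t; congr (_ * _); last by have /= := eq_co 0 isT; rewrite perm1.
by apply: IHn => e lt_e; have := eq_co e.+1 lt_e; rewrite expgS permM.
Qed.

(** On the elements whose top is the j-th power of the rotation, coordinate i of
    the (m/j)-th power is the product of the coordinates of g along the cycle of
    i.  The i < j represent the j cycles, so [chart] trades one coordinate in each
    cycle for the product along it. *)
Definition chart j g : {ffun 'I_m -> gT} :=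
  [ffun i : 'I_m => if i < j then bcoord (g ^+ (m %/ j)) i else bcoord g i].

(** Going backwards along its cycle, i < j does not return below j before the
    cycle closes. *)
Lemma rot_permVX j e (i : 'I_m) : j %| m -> 0 < e < m %/ j -> i < j ->
  (((rot_perm m ^+ j)^-1 ^+ e) i = i + (m - e * j) :> nat)%N.
Proof.
move=> dvd_jm /andP[e_gt0 lt_e] lt_ij.
have m_gt0 : 0 < m by apply: leq_trans (ltn_ord i).
have j_gt0 : 0 < j by apply: leq_trans lt_ij.
have le_ejm : e * j <= m by rewrite -[leqRHS](divnK dvd_jm) leq_mul2r ltnW ?orbT.
have -> : (rot_perm m ^+ j)^-1 ^+ e = rot_perm m ^+ (m - e * j).
  rewrite expgVn -expgM mulnC; apply: (mulgI (rot_perm m ^+ (e * j))).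
  by rewrite mulgV -expgD subnKC // rot_perm_expm.
rewrite rot_permX modn_small // addnBA // ltn_subLR ?(leq_trans le_ejm) ?leq_addl //.
by rewrite ltn_add2r (leq_trans lt_ij) // leq_pmull.
Qed.

(** In the product along the cycle of i < j, every factor but the last has an index
    at least j, where the chart does not alter the coordinates; hence the last
    factor, coordinate i itself, can be recovered. *)
Lemma chart_inj j g h : 0 < j -> j %| m ->
    top g = rot_perm m ^+ j -> top h = rot_perm m ^+ j ->
  chart j g = chart j h -> g = h.
Proof.
move=> j_gt0 dvd_jm top_g top_h /ffunP eq_gh; apply: wreath_ext => [|i].
  by rewrite top_g.
have := eq_gh i; rewrite !ffunE; case: ltnP => // lt_ij.
have m_gt0 : 0 < m by apply: leq_trans (ltn_ord i).
have mj_gt0 : 0 < m %/ j by rewrite divn_gt0 // dvdn_leq.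
rewrite -(prednK mj_gt0) !bcoordXS; set d := _.-1; rewrite top_h -top_g.
suff -> : bcoord (g ^+ d) ((top g)^-1 i) = bcoord (h ^+ d) ((top g)^-1 i).
  exact: mulgI.
apply: bcoordX_eq => [|e lt_e]; first by rewrite top_g.
have lt_e1 : e.+1 < m %/ j by rewrite -(prednK mj_gt0).
pose k : 'I_m := ((top g)^-1 ^+ e) ((top g)^-1 i); rewrite -/k.
have Ek : (k = i + (m - e.+1 * j) :> nat)%N.
  by rewrite -(@rot_permVX j) // /k top_g -permM -expgS.
have := eq_gh k; rewrite !ffunE ltnNge Ek; suff -> : j <= i + (m - e.+1 * j) by [].
have le2 : e.+2 * j <= m by rewrite -[leqRHS](divnK dvd_jm) leq_mul2r lt_e1 orbT.
apply: leq_trans (leq_addl _ _).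
rewrite leq_subRL ?(leq_trans _ le2) ?leq_mul2r ?leqnSn ?orbT //.
by rewrite addnC -mulSn.
Qed.

End Coordinates.

(** * Projections of a subgroup to the coordinates of the base *)

Lemma simple_nonabelian_perfect (gT : finGroupType) (S : {group gT}) :
  simple S -> ~~ abelian S -> S \subset [~: S, S].
Proof.
move=> S_simple S_nonabelian.
have [_ /(_ _ (der_normal 1 S))[/= /derG1P abS|/= {1}<-]] := simpleP _ S_simple.
  by case/negP: S_nonabelian.
by rewrite derg1.
Qed.

Section Projections.

Variables (gT : finGroupType) (m : nat).
Local Notation W := (wreath_type gT m).
Implicit Types (g h : W) (S : {group gT}) (K : {group W}).

(** The part of K in the base with trivial coordinates at s; it is the whole of
    the intersection of K with the base when s is empty. *)
Definition base_vanish K (s : seq 'I_m) : {set W} :=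
  [set g in K | (top g == 1) && all (fun i => bcoord g i == 1) s].

Lemma base_vanishP K s g :
  reflect [/\ g \in K, top g = 1 & {in s, forall i, bcoord g i = 1}]
          (g \in base_vanish K s).
Proof.
rewrite inE; apply: (iffP and3P) => [[Kg /eqP-> /allP s1]|[Kg -> s1]].
  by split=> // i /s1/eqP.
by split=> //; apply/allP=> i /s1->.
Qed.

Lemma group_set_base_vanish K s : group_set (base_vanish K s).
Proof.
apply/group_setP; split; first by apply/base_vanishP; split=> // i _; rewrite bcoord1.
move=> g h /base_vanishP[Kg tg sg] /base_vanishP[Kh th sh].
apply/base_vanishP; split; rewrite ?groupM // ?topM ?tg ?th ?mulg1 // => i si.
by rewrite bcoordM th invg1 perm1 sg // sh ?mulg1.
Qed.
Canonical base_vanish_group K s := Group (group_set_base_vanish K s).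

Definition base_proj K s (i : 'I_m) : {set gT} :=
  [set bcoord g i | g in base_vanish K s].

Lemma group_set_base_proj K s i : group_set (base_proj K s i).
Proof.
apply/group_setP; split; first by apply/imsetP; exists 1; rewrite ?group1 ?bcoord1.
move=> _ _ /imsetP[g Dg ->] /imsetP[h Dh ->].
apply/imsetP; exists (g * h); first exact: groupM.
by case/base_vanishP: Dh => _ th _; rewrite bcoordM th invg1 perm1.
Qed.
Canonical base_proj_group K s i := Group (group_set_base_proj K s i).

Lemma bcoordJ g h i : top g = 1 ->
  bcoord (g ^ h) i = bcoord g ((top h)^-1 i) ^ bcoord h i.
Proof.
move=> tg; have: bcoord (h * (g ^ h)) i = bcoord (g * h) i by rewrite -conjgC.
have tgh : top (g ^ h) = 1 by rewrite !topM topV tg mul1g mulVg.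
rewrite !bcoordM tgh invg1 perm1 => /(canRL (mulKg _)) ->.
by rewrite /conjg mulgA.
Qed.

Lemma top_conj g h : top (g ^ h) = top g ^ top h.
Proof. by rewrite /conjg !topM topV. Qed.

Lemma bcoord_ratio g h i :
  top g = top h -> bcoord (g^-1 * h) i = (bcoord g i)^-1 * bcoord h i.
Proof.
move=> tgh; apply: (mulgI (bcoord g i)); rewrite mulKVg.
have E : h = g * (g^-1 * h) by rewrite mulKVg.
rewrite {2}E bcoordM; congr (bcoord g _ * _).
by rewrite topM topV tgh mulVg invg1 perm1.
Qed.

Variables (S : {group gT}) (K : {group W}).
Hypotheses (m_gt0 : 0 < m) (sKW : K \subset wreath m S).

Lemma base_proj_sub s i : base_proj K s i \subset S.
Proof.
apply/subsetP=> _ /imsetP[g /base_vanishP[Kg _ _] ->].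
by have:= subsetP sKW g Kg; rewrite mem_wreath => /forallP.
Qed.

(** K is full when it supplements the base, that is, when its image in the group
    of rotations contains the generator. *)
Definition full := [exists g in K, top g == rot_perm m].

Hypothesis fullK : full.

Lemma full_top n : exists2 g, g \in K & top g = rot_perm m ^+ n.
Proof.
case/exists_inP: fullK => g Kg /eqP tg.
by exists (g ^+ n); rewrite ?groupX // topX tg.
Qed.

Lemma full_trans i i' : exists2 g, g \in K & top g i' = i.
Proof.
have [g Kg tg] := full_top (m - i' + i); exists g => //; rewrite tg.
by apply: ord_inj; rewrite rot_permX addnA subnKC ?modnDl ?modn_small // ltnW.
Qed.

Lemma base_vanishJ g i : g \in K ->
  base_vanish K [:: top g i] = base_vanish K [:: i] :^ g.
Proof.
move=> Kg; apply/setP=> h; rewrite mem_conjg !inE groupJr ?groupV //=.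
rewrite top_conj (can2_eq (conjgK _) (conjgKV _)) conj1g andbA [RHS]andbA.
case: eqP => [th|]; last by rewrite !andbF.
by rewrite bcoordJ // topV invgK (can2_eq (conjgK _) (conjgKV _)) conj1g.
Qed.

(** A full subgroup permutes the coordinates transitively, and conjugation by its
    elements carries one projection to another. *)
Lemma card_base_proj i i' : #|base_proj K [::] i| = #|base_proj K [::] i'|.
Proof.
suff le_proj j j' : #|base_proj K [::] j| <= #|base_proj K [::] j'|.
  by apply/eqP; rewrite eqn_leq !le_proj.
have [g Kg <-] := full_trans j' j.
rewrite -(cardJg _ (bcoord g (top g j))); apply: subset_leq_card.
apply/subsetP=> _ /imsetP[_ /imsetP[h /base_vanishP[Kh th _] ->] ->].
apply/imsetP; exists (h ^ g); last by rewrite bcoordJ // permK.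
by apply/base_vanishP; split; rewrite ?groupJ // top_conj th conj1g.
Qed.

Lemma card_base_vanish1 i i' : #|base_vanish K [:: i]| = #|base_vanish K [:: i']|.
Proof. by have [g Kg <-] := full_trans i' i; rewrite base_vanishJ // cardJg. Qed.

Definition top_fibre (j : nat) : {set W} :=
  [set g in K | top g == rot_perm m ^+ j].

Lemma card_top_fibre j : #|top_fibre j| = #|base_vanish K [::]|.
Proof.
have [h Kh th] := full_top j.
rewrite -[RHS](card_imset _ (mulgI h)); congr #|pred_of_set _|; apply/setP=> g.
apply/idP/imsetP=> [|[{}g /base_vanishP[Kg tg _] ->]].
  rewrite inE => /andP[Kg /eqP tg]; exists (h^-1 * g); last by rewrite mulKVg.
  by apply/base_vanishP; split; rewrite ?groupM ?groupV // topM topV tg th mulVg.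
by rewrite inE groupM //= topM tg mulg1 th.
Qed.

(** The box for the part of K over the j-th power of the rotation.  An arbitrary
    element of that part serves as representative of the cosets, so the value is
    meaningful only when there is one. *)
Definition coset_box j (i : 'I_m) : {set gT} :=
  if i < j then base_proj K [::] i
  else bcoord (repr (top_fibre j)) i *: base_proj K [::] i.

(** A coordinate below j of the chart is one of an element of K in the base.  In
    the other coordinates, two elements of K with the same top differ by an
    element of K in the base. *)
Lemma chart_in_coset_box j g i : 0 < j -> j %| m -> g \in top_fibre j ->
  chart j g i \in coset_box j i.
Proof.
move=> j_gt0 dvd_jm Fg; rewrite ffunE /coset_box; case: ifP => _.
  apply: imset_f; move: Fg; rewrite inE => /andP[Kg /eqP tg].
  apply/base_vanishP; split=> //; first exact: groupX.
  by rewrite topX tg -expgM mulnC divnK // rot_perm_expm.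
have:= mem_repr _ Fg; move: (repr _) => h; rewrite mem_lcoset.
move: Fg; rewrite !inE => /andP[Kg /eqP tg] /andP[Kh /eqP th].
rewrite -bcoord_ratio ?th //; apply: imset_f; apply/base_vanishP.
by split; rewrite ?groupM ?groupV // topM topV tg th mulVg.
Qed.

Lemma card_coset_box j i i' : #|coset_box j i| = #|base_proj K [::] i'|.
Proof.
by rewrite /coset_box; case: ifP; rewrite ?card_lcoset (card_base_proj _ i').
Qed.

Section Subdirect.

Hypotheses (S_simple : simple S) (S_nonabelian : ~~ abelian S).
Hypothesis subdirect : forall i, base_proj K [::] i = S.

(** The kernels of the projections to i and to j have the same order, so they are
    equal as soon as one is contained in the other. *)
Lemma base_proj1_trivial i j : base_proj K [:: i] j = 1 ->
  base_vanish K [:: i] = base_vanish K [:: j].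
Proof.
move=> tr; apply/eqP; rewrite eqEcard (card_base_vanish1 j i) leqnn andbT.
apply/subsetP=> g Dg; have [Kg tg _] := base_vanishP _ _ _ Dg.
apply/base_vanishP; split=> // k /[!inE]/eqP->.
by apply/set1P; rewrite -[[set 1]]/[1 gT] -tr; apply: imset_f.
Qed.

Lemma base_proj1_normal i j : base_proj K [:: i] j <| S.
Proof.
rewrite /normal base_proj_sub /=; apply/subsetP=> x; rewrite -(subdirect j).
case/imsetP=> h /base_vanishP[Kh th _] ->{x}; rewrite inE.
apply/subsetP=> _ /imsetP[_ /imsetP[g /base_vanishP[Kg tg g1] ->] ->].
apply/imsetP; exists (g ^ h); last by rewrite bcoordJ // th invg1 perm1.
apply/base_vanishP; split; rewrite ?groupJ // ?top_conj ?tg ?conj1g // => k ik.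
by rewrite bcoordJ // th invg1 perm1 (g1 k ik) conj1g.
Qed.

(** If the kernels of the projections to the coordinates are distinct, K contains
    elements that vanish at s and take any given value at j.  For one index in s,
    the values form a nontrivial normal subgroup of S.  For more, take
    commutators: [~ g, h] vanishes where g or h does, and S is perfect. *)
Lemma base_vanish_separated s j : injective (fun i => base_vanish K [:: i]) ->
  j \notin s -> base_proj K s j = S.
Proof.
move=> injK; elim: s => [|i s IHs]; first by rewrite subdirect.
rewrite inE negb_or => /andP[ne_ji /IHs{}IHs].
apply/eqP; rewrite eqEsubset base_proj_sub /=.
apply: subset_trans (simple_nonabelian_perfect S_simple S_nonabelian) _.
rewrite gen_subG.
have proj_i : base_proj K [:: i] j = S.
  have [_ /(_ _ (base_proj1_normal i j))[/= tr|//]] := simpleP _ S_simple.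
  by case/eqP: ne_ji; apply/injK/esym/base_proj1_trivial.
apply/subsetP=> z /imset2P[x y]; rewrite -{1}IHs -proj_i => + + ->{z}.
move=> /imsetP[g /base_vanishP[Kg tg g1] ->] /imsetP[h /base_vanishP[Kh th h1] ->].
apply/imsetP; exists [~ g, h].
  apply/base_vanishP; split; first by rewrite groupR.
    by rewrite topM topV top_conj tg conj1g mulg1 invg1.
  move=> k; rewrite commgEl bcoord_ratio; last by rewrite top_conj tg conj1g.
  rewrite bcoordJ // th invg1 perm1 => /[!inE] /predU1P[->|sk].
    by rewrite (h1 i) ?mem_head // conjg1 mulVg.
  by rewrite (g1 k sk) conj1g mulg1 invg1.
rewrite commgEl bcoord_ratio; last by rewrite top_conj tg conj1g.
by rewrite bcoordJ // th invg1 perm1 -commgEl.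
Qed.

(** With s the set of all indices but j, [base_vanish_separated] puts the j-th
    factor of the base in K, for each j. *)
Lemma subdirect_inj_whole : injective (fun i => base_vanish K [:: i]) ->
  K :=: wreath m S.
Proof.
move=> injK; apply/eqP; rewrite eqEsubset sKW; apply/subsetP=> g.
rewrite mem_wreath => /forallP Sg; have [n tg] := top_rotX g.
have [h Kh th] := full_top n; rewrite -(groupMr _ (groupVr Kh)).
have{th} tgh : top (g * h^-1) = 1 by rewrite topM topV th tg mulgV.
have: forall i, bcoord (g * h^-1) i \in S.
  apply/forallP; rewrite -mem_wreath groupM ?groupV ?(subsetP sKW h) //.
  by rewrite mem_wreath; apply/forallP.
move: (g * _) tgh => {g h Kh tg Sg n}g tg Sg.
pose mkd (x : gT) (j : 'I_m) := wreath_elt [ffun i => if i == j then x else 1] 0.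
have Kd x j : x \in S -> mkd x j \in K.
  rewrite -(@base_vanish_separated [seq i <- enum 'I_m | i != j] j) //; last first.
    by rewrite mem_filter eqxx.
  case/imsetP=> d /base_vanishP[Kd td d1] ->.
  suff -> : mkd (bcoord d j) j = d by [].
  apply: wreath_ext => [|i]; first by rewrite top_elt td.
  rewrite bcoord_elt ffunE; case: eqP => [->//|/eqP ne_ij].
  by rewrite d1 // mem_filter ne_ij mem_enum.
(* The product of the coordinates of g below n, each in its own factor. *)
pose trunc (n : nat) := wreath_elt [ffun i : 'I_m => if i < n then bcoord g i else 1] 0.
have: trunc m = g.
  apply: wreath_ext => [|i]; first by rewrite top_elt tg.
  by rewrite bcoord_elt ffunE ltn_ord.
move <-; suff: forall n, n <= m -> trunc n \in K by apply.
elim=> [|n IHn] lt_nm.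
  suff -> : trunc 0%N = 1 by apply: group1.
  by apply: wreath_ext => [|i]; rewrite ?top_elt // bcoord_elt ffunE bcoord1.
suff -> : trunc n.+1 = trunc n * mkd (bcoord g (Ordinal lt_nm)) (Ordinal lt_nm).
  by rewrite groupM ?Kd // IHn // ltnW.
apply: wreath_ext => [|i]; first by rewrite topM !top_elt mulg1.
rewrite bcoordM !bcoord_elt top_elt invg1 perm1 !ffunE ltnS leq_eqVlt.
rewrite -val_eqE /=; case: eqP => [Ei|_] /=; last by rewrite mulg1.
by rewrite Ei ltnn mul1g; congr (bcoord g _); apply: val_inj.
Qed.

(** Partition the coordinates according to the kernels of the projections from
    K.  K permutes the blocks transitively, so they have a common size t, which
    divides m, and t > 1 since K is proper ([subdirect_inj_whole]).  An element of
    K in the base is determined by its coordinates at one index in each of the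
    m / t blocks. *)
Lemma card_base_diagonal : K \proper wreath m S ->
  #|base_vanish K [::]| <= #|S| ^ (m %/ pdiv m).
Proof.
move=> prK; pose ker i := base_vanish K [:: i].
pose P := preim_partition ker setT.
have Ppart : partition P [set: 'I_m] by apply: preim_partitionP.
have ker_eq i j : (j \in pblock P i) = (ker i == ker j).
  rewrite pblock_equivalence_partition ?inE //.
  by split=> // /eqP->.
have kerJ i j g : g \in K -> (ker (top g i) == ker (top g j)) = (ker i == ker j).
  by move=> Kg; rewrite /ker !base_vanishJ // (inj_eq (@conjsg_inj _ g)).
pose o : 'I_m := Ordinal m_gt0.
have card_blocks A : A \in P -> #|A| = #|pblock P o|.
  have [_ tiP P0] := and3P Ppart; move=> PA.
  have /set0Pn[i Ai] : A != set0 by apply: contraNneq P0 => <-.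
  rewrite -(def_pblock tiP PA Ai); have [g Kg <-] := full_trans i o.
  rewrite -[RHS](card_imset _ (@perm_inj _ (top g))).
  congr #|pred_of_set _|; apply/setP=> j; apply/idP/imsetP => [|[k]].
    rewrite ker_eq -{1}[j](permKV (top g)) kerJ // -ker_eq => Pj.
    by exists ((top g)^-1 j) => //; rewrite permKV.
  by move=> Pk ->; rewrite ker_eq kerJ // -ker_eq.
have cardP := card_uniform_partition card_blocks Ppart.
rewrite cardsT card_ord in cardP.
set t := #|pblock P o| in cardP card_blocks.
have t_gt0 : 0 < t by apply/card_gt0P; exists o; rewrite ker_eq.
have t_gt1 : 1 < t.
  rewrite ltn_neqAle t_gt0 andbT eq_sym; apply: contraTneq prK => t1.
  rewrite subdirect_inj_whole ?properxx // => i j /eqP eq_ij.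
  have /eqP/cards1P[k Ek] : #|pblock P i| = 1%N.
    rewrite -t1; apply/card_blocks/pblock_mem.
    by case/and3P: Ppart => /eqP->; rewrite inE.
  have: i \in pblock P i by rewrite ker_eq.
  have: j \in pblock P i by rewrite ker_eq eq_ij.
  by rewrite Ek => /set1P-> /set1P->.
pose X := transversal P setT.
have trX := transversalP Ppart.
have cardX := card_transversal trX.
have leP : #|P| <= m %/ pdiv m.
  have -> : #|P| = m %/ t by rewrite -(mulnK #|P| t_gt0) -cardP.
  apply: leq_div2l (pdiv_gt0 m) _; apply: pdiv_min_dvd => //.
  by apply/dvdnP; exists #|P|.
apply: leq_trans (leq_pexp2l (cardG_gt0 S) leP).
rewrite -cardX -(card_pffun_on (1 : gT)).
pose res g : {ffun 'I_m -> gT} := [ffun i => if i \in X then bcoord g i else 1].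
have res_inj : {in base_vanish K [::] &, injective res}.
  move=> g h Dg Dh /ffunP eq_gh; apply/eqP; rewrite eq_mulVg1; apply/eqP.
  case/base_vanishP: Dg Dh => Kg tg _ /base_vanishP[Kh th _].
  apply: wreath_ext => [|i]; first by rewrite topM topV tg th mulVg.
  rewrite bcoord1; pose k := transversal_repr i X (pblock P i).
  have Pi : pblock P i \in P.
    by apply: pblock_mem; case/and3P: Ppart => /eqP->; rewrite inE.
  have Xk : k \in X := repr_mem_transversal trX i Pi.
  have: k \in pblock P i := repr_mem_pblock trX i Pi.
  rewrite ker_eq => /eqP/setP/(_ (g^-1 * h)) eq_ker.
  have Dgh : g^-1 * h \in ker k.
    apply/base_vanishP; split; rewrite ?groupM ?groupV // ?topM ?topV ?tg ?th ?mulVg //.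
    move=> e /[!inE]/eqP->; rewrite bcoord_ratio ?tg //.
    by have := eq_gh k; rewrite !ffunE Xk => ->; rewrite mulVg.
  by move: Dgh; rewrite -eq_ker => /base_vanishP[_ _]; apply; rewrite inE.
rewrite -(card_in_imset res_inj); apply: subset_leq_card.
apply/subsetP=> _ /imsetP[g Dg ->]; apply/pffun_onP; split.
  by apply/subsetP=> i; rewrite inE ffunE; case: ifP; rewrite ?eqxx.
move=> _ /imageP[i Xi ->]; rewrite ffunE Xi.
by case/base_vanishP: Dg => /(subsetP sKW); rewrite mem_wreath => /forallP.
Qed.

End Subdirect.
End Projections.

(** * The upper bound *)

(** An element of S generates a cyclic subgroup, which is proper. *)
Lemma nonabelian_has_covering (gT : finGroupType) (S : {group gT}) :
  ~~ abelian S -> exists N, is_covering S N.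
Proof.
move=> nabS; exists [set H : {group gT} | H \proper S].
apply/andP; split; first by apply/forall_inP=> H; rewrite inE.
rewrite eqEsubset; apply/andP; split; first by apply/bigcupsP=> H /[!inE]/proper_sub.
apply/subsetP=> x Sx; apply/bigcupP; exists <[x]>%G; last exact: cycle_id.
rewrite inE properEneq cycle_subG Sx andbT.
by apply: contraNneq nabS => <-; apply: cycle_abelian.
Qed.

Section Upper.

Variables (gT : finGroupType) (m : nat) (S : {group gT}).
Hypothesis m_ge2 : (2 <= m)%N.
Local Notation W := (wreath_type gT m).
Let m_gt0 : (0 < m)%N := ltnW m_ge2.
Let o0 : 'I_m := Ordinal m_gt0.
Local Notation gam := (rot_perm m).

Definition over_base (r : nat) : {set W} :=
  [set g in wreath m S | top g \in <[gam ^+ r]>].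

Lemma group_set_over_base r : group_set (over_base r).
Proof.
apply/group_setP; split=> [|g h]; first by rewrite inE group1 top1 group1.
by rewrite !inE topM => /andP[Wg tg] /andP[Wh th]; rewrite !groupM.
Qed.
Canonical over_base_group r := Group (group_set_over_base r).

Lemma over_base_proper r : prime r -> r %| m -> over_base_group r \proper wreath m S.
Proof.
move=> pr_r dvd_rm; apply/properP; split; first by apply/subsetP=> g /setIdP[].
exists (wreath_elt [ffun=> 1] 1).
  by rewrite mem_wreath; apply/forallP=> i; rewrite bcoord_elt ffunE.
rewrite inE top_elt expg1 negb_and; apply/orP; right; rewrite -cycle_subG.
apply/negP=> /subset_leq_card; rewrite -!orderE orderXdiv order_rot_perm //.
by rewrite leqNgt ltn_Pdiv // prime_gt1.
Qed.

(** The stabiliser of a tuple of right cosets in the product action of the wreath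
    product.  The tuples that start with M itself suffice to cover, and there are
    |S : M|^(m-1) of them. *)
Definition tuple_stab (c : {ffun 'I_m -> {set gT}}) : {set W} :=
  [set g in wreath m S | [forall i, c ((top g)^-1 i) :* bcoord g i == c i]].

Lemma tuple_stabP (c : {ffun 'I_m -> {set gT}}) g : reflect
  (g \in wreath m S /\ forall i, c ((top g)^-1 i) :* bcoord g i = c i)
  (g \in tuple_stab c).
Proof.
rewrite inE; apply: (iffP andP) => -[Wg cg]; split=> //.
  by move=> i; apply/eqP/(forallP cg).
by apply/forallP=> i; rewrite cg.
Qed.

Lemma group_set_tuple_stab c : group_set (tuple_stab c).
Proof.
apply/group_setP; split=> [|g h].
  apply/tuple_stabP; split=> [|i]; first exact: group1.
  by rewrite top1 invg1 perm1 bcoord1 mulg1.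
case/tuple_stabP=> Wg cg /tuple_stabP[Wh ch].
apply/tuple_stabP; split=> [|i]; first exact: groupM.
by rewrite bcoordM rcosetM topM invMg permM cg ch.
Qed.
Canonical tuple_stab_group c := Group (group_set_tuple_stab c).

Definition based_cosets (M : {group gT}) : {set {ffun 'I_m -> {set gT}}} :=
  boxset (fun i => if i == o0 then [set gval M] else rcosets M S).

Lemma card_based_cosets M : #|based_cosets M| = (#|S : M| ^ m.-1)%N.
Proof.
rewrite card_boxset (bigD1 o0) //= cards1 mul1n.
rewrite (eq_bigr (fun _ => #|S : M|)) => [|i /negPf->//].
by rewrite prod_nat_const -[m in m.-1]card_ord -(cardC1 o0).
Qed.

Lemma tuple_stab_proper (M : {group gT}) c : M \proper S -> c \in based_cosets M ->
  tuple_stab_group c \proper wreath m S.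
Proof.
case/properP=> sMS [x Sx nMx] /boxsetP/(_ o0); rewrite eqxx => /set1P c0.
apply/properP; split; first by apply/subsetP=> g /tuple_stabP[].
exists (wreath_elt [ffun=> x] 0).
  by rewrite mem_wreath; apply/forallP=> i; rewrite bcoord_elt ffunE.
apply: contra nMx => /tuple_stabP[_ /(_ o0)].
rewrite top_elt invg1 perm1 bcoord_elt ffunE c0 => Mx.
by rewrite -Mx rcoset_refl.
Qed.

(** The coset at the place that is reached from 0 after e steps of the cycle of g
    is M times the product of the coordinates met on the way, that is, coordinate
    (a^e 0) of g^e.  Running once more through the cycle multiplies it on the left
    by coordinate 0 of g^m, which is in M, so the choice of e is immaterial. *)
Lemma tuple_stabilised g k (M : {group gT}) :
    M \subset S -> g \in wreath m S -> top g = gam ^+ k -> coprime k m ->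
    bcoord (g ^+ m) o0 \in M ->
  exists2 c, c \in based_cosets M & g \in tuple_stab c.
Proof.
move=> sMS Wg tg co_km My; set a := top g.
have am : a ^+ m = 1.
  by rewrite /a tg -expgM mulnC expgM rot_perm_expm ?expg1n.
have aE e : (a ^+ e) o0 = (k * e) %% m :> nat.
  by rewrite /a tg -expgM rot_permX add0n.
have Sbc h i : h \in wreath m S -> bcoord h i \in S by rewrite mem_wreath => /forallP.
have shift q e : M :* bcoord (g ^+ (e + m * q)) ((a ^+ e) o0)
                 = M :* bcoord (g ^+ e) ((a ^+ e) o0).
  rewrite addnC expgD bcoordM topX -/a permK rcosetM.
  congr (_ :* _); apply: rcoset_id.
  rewrite expgM; elim: q => [|q IHq]; first by rewrite expg0 bcoord1 group1.
  by rewrite bcoordXS topX -/a am invg1 perm1 groupM.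
have same e e' i : (a ^+ e) o0 = i -> (a ^+ e') o0 = i ->
    M :* bcoord (g ^+ e) i = M :* bcoord (g ^+ e') i.
  wlog le_ee : e e' / (e <= e')%N => [WLOG|] Ei Ei'.
    by case: (leqP e e') => [|/ltnW] /WLOG->.
  have: (k * e' == k * e %[mod m])%N by rewrite -!aE Ei Ei'.
  rewrite eqn_mod_dvd ?leq_mul // -mulnBr Gauss_dvdr 1?coprime_sym //.
  case/dvdnP=> q Eq; rewrite -(subnKC le_ee) Eq mulnC -Ei.
  exact/esym/shift.
have k_gt0 : (0 < k)%N.
  case: k co_km {tg aE} => // /eqP; rewrite gcd0n => m1.
  by move: m_ge2; rewrite m1.
(* k times (egcdn k m).1 is 1 modulo m, so that ex i steps lead from 0 to i. *)
pose ex (i : 'I_m) : nat := (i * (egcdn k m).1)%N.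
have exP i : (a ^+ ex i) o0 = i.
  apply: ord_inj; rewrite aE /ex mulnCA [(k * _)%N]mulnC.
  have [u v E _] := egcdnP m k_gt0; rewrite /= E (eqP co_km) mulnDr muln1 mulnA.
  by rewrite modnMDl modn_small.
exists [ffun i => M :* bcoord (g ^+ ex i) i].
  apply/boxsetP=> i; rewrite ffunE; case: eqP => [->|_].
    by rewrite /ex /= mul0n expg0 bcoord1 mulg1; apply/set1P.
  by apply/rcosetsP; exists (bcoord (g ^+ ex i) i); rewrite ?Sbc ?groupX.
apply/tuple_stabP; split=> // i; rewrite !ffunE -rcosetM -/a.
rewrite -bcoordXS; apply: same => //.
by rewrite expgSr permM exP permKV.
Qed.

Variable N : {set {group gT}}.
Hypothesis covN : is_covering S N.

Definition wreath_cover : {set {group W}} :=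
  [set over_base_group (val r) | r : 'I_m.+1 & val r \in primes m]
    :|: \bigcup_(M in N) [set tuple_stab_group c | c in based_cosets M].

Lemma card_wreath_cover :
  (#|wreath_cover| <= alpha m + \sum_(M in N) #|S : M| ^ m.-1)%N.
Proof.
apply: leq_trans (card_setU_le _ _) _; apply: leq_add.
  apply: leq_trans (leq_imset_card _ _) _.
  rewrite cardE -(size_map val); apply: uniq_leq_size.
    by rewrite map_inj_uniq ?enum_uniq //; apply: val_inj.
  by move=> _ /mapP[r + ->]; rewrite mem_enum inE.
apply: leq_trans (card_bigcup_le _ _) _; apply: leq_sum => M _.
by apply: leq_trans (leq_imset_card _ _) _; rewrite card_based_cosets.
Qed.

Lemma wreath_coverP : is_covering (wreath m S) wreath_cover.
Proof.
have /andP[/forall_inP prN /eqP unionN] := covN.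
have prK K : K \in wreath_cover -> K \proper wreath m S.
  rewrite inE => /orP[/imsetP[r + ->]|/bigcupP[M NM /imsetP[c cM ->]]].
    rewrite inE mem_primes => /and3P[pr_r _ dvd_rm]; exact: over_base_proper.
  by apply: tuple_stab_proper cM; apply: prN.
apply/andP; split; first exact/forall_inP.
rewrite eqEsubset; apply/andP; split; first by apply/bigcupsP=> K /prK/proper_sub.
apply/subsetP=> g Wg; have [k tg] := top_rotX g.
case: (boolP (coprime k m)) => [co_km|nco].
  have: bcoord (g ^+ m) o0 \in S.
    by have := groupX m Wg; rewrite mem_wreath => /forallP.
  rewrite -unionN => /bigcupP[M NM My].
  have [c cM cg] := tuple_stabilised (proper_sub (prN M NM)) Wg tg co_km My.
  apply/bigcupP; exists (tuple_stab_group c) => //; rewrite inE; apply/orP; right.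
  by apply/bigcupP; exists M => //; apply/imsetP; exists c.
pose r := pdiv (gcdn k m).
have gcd_gt1 : (1 < gcdn k m)%N by rewrite ltn_neqAle eq_sym nco gcdn_gt0 m_gt0 orbT.
have dvd_rk : r %| k := dvdn_trans (pdiv_dvd _) (dvdn_gcdl _ _).
have dvd_rm : r %| m := dvdn_trans (pdiv_dvd _) (dvdn_gcdr _ _).
have lt_r : (r < m.+1)%N by rewrite ltnS dvdn_leq.
apply/bigcupP; exists (over_base_group r).
  rewrite inE; apply/orP; left; apply/imsetP; exists (Ordinal lt_r) => //.
  by rewrite inE mem_primes pdiv_prime // m_gt0 dvd_rm.
by rewrite inE Wg tg -(divnK dvd_rk) mulnC expgM mem_cycle.
Qed.

End Upper.

(** * The lower bound *)

Lemma alpha_gt0 m : (2 <= m)%N -> (0 < alpha m)%N.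
Proof.
move=> m2; rewrite /alpha -has_predT; apply/hasP; exists (pdiv m) => //.
by rewrite mem_primes pdiv_prime // pdiv_dvd (ltnW m2).
Qed.

(** The excess 2^(m-1)/5 found on the lines must be greater than alpha(m) - 1;
    alpha(m) < m is enough for this from m = 5 on. *)
Lemma alpha_bound m : (2 <= m)%N -> (5 * alpha m < 2 ^ m.-1 + 5)%N.
Proof.
case: (ltnP m 5) => [|m5 _]; first by do 5![case: m => [|m] //].
have : (alpha m <= m.-1)%N.
  rewrite -(size_iota 2 m.-1); apply: uniq_leq_size (primes_uniq m) _ => p.
  rewrite mem_primes mem_iota => /and3P[/prime_gt1-> m_gt0 /(dvdn_leq m_gt0) le_pm].
  by rewrite add2n prednK.
have: (5 * m.-1 < 2 ^ m.-1 + 5)%N.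
  rewrite -(subnKC m5) addSn /=; elim: (m - 5)%N => // k IHk.
  rewrite addnS expnS; move: IHk; set e := (2 ^ _)%N; have : (16 <= e)%N; last by lia.
  by rewrite (@leq_pexp2l 2 4).
by lia.
Qed.

(** The chart is injective into S^m, on a set of |S|^m elements. *)
Lemma chart_onto (gT : finGroupType) (m : nat) (S : {group gT}) j
    (u : {ffun 'I_m -> gT}) : (0 < j)%N -> j %| m ->
    u \in boxset (fun=> S) ->
  exists g, [/\ g \in wreath m S, top g = rot_perm m ^+ j & chart j g = u].
Proof.
move=> j_gt0 dvd_jm Su; pose F := top_fibre (wreath m S) j.
have FP g : g \in F -> g \in wreath m S /\ top g = rot_perm m ^+ j.
  by rewrite inE => /andP[Wg /eqP].
suff: u \in chart j @: F by case/imsetP=> g /FP[Wg tg] ->; exists g.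
suff /eqP-> : chart j @: F == boxset (fun=> S) by [].
rewrite eqEcard; apply/andP; split.
  apply/subsetP=> _ /imsetP[g /FP[Wg tg] ->]; apply/boxsetP=> i; rewrite ffunE.
  have Sbc h : h \in wreath m S -> bcoord h i \in S by rewrite mem_wreath => /forallP.
  by case: ifP => _; rewrite Sbc ?groupX.
rewrite card_in_imset => [|g h /FP[_ tg] /FP[_ th]]; last exact: chart_inj.
have mk_inj : injective (fun x : {ffun 'I_m -> gT} => wreath_elt x j).
  by move=> x y eq_xy; apply/ffunP=> i; rewrite -(bcoord_elt x j) eq_xy bcoord_elt.
rewrite -(card_imset _ mk_inj); apply: subset_leq_card.
apply/subsetP=> _ /imsetP[x /boxsetP Sx ->]; rewrite inE top_elt eqxx andbT.
by rewrite mem_wreath; apply/forallP=> i; rewrite bcoord_elt.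
Qed.

(** By Bezout: if the image of K in the group of rotations contains two powers of
    the generator with coprime exponents, it contains the generator. *)
Lemma top_fibre_coprime (gT : finGroupType) (m : nat)
    (K : {group wreath_type gT m}) r s : (0 < r)%N -> coprime r s ->
  top_fibre K r != set0 -> top_fibre K s != set0 -> full K.
Proof.
move=> r_gt0 /eqP co_rs /set0Pn[g /setIdP[Kg /eqP tg]].
move=> /set0Pn[h /setIdP[Kh /eqP th]].
have [a b E _] := egcdnP s r_gt0; rewrite co_rs addn1 in E.
apply/exists_inP; exists (g ^+ a * (h ^+ b)^-1).
  by rewrite groupM ?groupV ?groupX.
by rewrite topM topV !topX tg th -!expgM mulnC E mulnC expgS mulgK.
Qed.

Section Lower.

Variables (gT : finGroupType) (S : {group gT}) (Sigma : {set gT}) (m : nat).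
Variable Ms : {set {group gT}}.
Hypotheses (S_simple : simple S) (S_nonabelian : ~~ abelian S) (m_ge2 : (2 <= m)%N).
Hypothesis Sigma_sub : Sigma \subset S.
Hypothesis Ms_n0 : Ms != set0.
Hypothesis Ms_max : forall M : {group gT}, M \in Ms -> maximal M S.
Hypothesis meetM : forall M : {group gT}, M \in Ms -> Sigma :&: M != set0.
Hypothesis tiM : forall M1 M2 : {group gT}, M1 \in Ms -> M2 \in Ms -> M1 != M2 ->
  Sigma :&: M1 :&: M2 = set0.
Local Notation hits M := (#|Sigma :&: M| * #|M| ^ m.-1)%N.
Hypothesis le_diag : forall M : {group gT}, M \in Ms ->
  ((1 + alpha m) * #|S| ^ (m %/ pdiv m) <= hits M)%N.
Hypothesis le_other : forall H M : {group gT},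
  H \proper S -> H \notin Ms -> M \in Ms -> (hits H <= hits M)%N.

(** The sets Sigma :&: M are disjoint, so at most one term is nonzero.  The
    normalisation gives weight 1 to each box with projection M in S^m. *)
Definition weight (y : gT) : rat :=
  (\sum_(M in Ms | y \in Sigma :&: M) (hits M)%:R^-1)%R.

Lemma weight_ge0 y : (0 <= weight y)%R.
Proof. by apply: sumr_ge0 => M _; rewrite invr_ge0. Qed.

Lemma weight_out y : y \notin Sigma -> weight y = 0%R.
Proof.
by move=> ny; rewrite /weight big_pred0 // => M; rewrite inE (negPf ny) andbF.
Qed.

Lemma weight_in M y : M \in Ms -> y \in Sigma :&: M ->
  weight y = ((hits M)%:R^-1)%R.
Proof.
move=> MsM SMy; rewrite /weight (bigD1 M) ?MsM //= big1 ?addr0 // => N.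
case/andP=> /andP[MsN SNy] neNM; have := tiM MsM MsN; rewrite eq_sym => /(_ neNM).
by move/setP/(_ y); move: SMy SNy; rewrite !inE => /andP[-> ->] ->.
Qed.

Lemma weight_le t y : (0 < t)%N ->
  (forall M : {group gT}, M \in Ms -> t <= hits M)%N -> (weight y <= (t%:R)^-1)%R.
Proof.
move=> t_gt0 le_t.
case: (pickP (fun M : {group gT} => (M \in Ms) && (y \in Sigma :&: M))) => [M|none].
  case/andP=> MsM SMy; rewrite (weight_in MsM SMy).
  rewrite lef_pV2 ?posrE ?ltr0n ?ler_nat ?le_t //.
  by apply: leq_trans t_gt0 (le_t M MsM).
by rewrite /weight big_pred0 // invr_ge0.
Qed.

(** For H among the given maximal subgroups, this is an equality by the choice of
    the weight.  For the others, the hypothesis on sizes bounds every weight by the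
    inverse of hits H. *)
Lemma weight_subgroup (H : {group gT}) : H \proper S ->
  (wt weight H * (#|H| ^ m.-1)%:R <= 1)%R.
Proof.
move=> prH; have -> : wt weight H = wt weight (Sigma :&: H).
  rewrite /wt big_mkcond [RHS]big_mkcond; apply: eq_bigr => y _; rewrite inE.
  by case: (boolP (y \in Sigma)) => //= /weight_out->; case: ifP.
have [SH0|SH_n0] := set_0Vmem (Sigma :&: H); first by rewrite SH0 /wt big_set0 mul0r.
have {SH_n0} SH_gt0 : (0 < #|Sigma :&: H|)%N.
  by case: SH_n0 => y Hy; apply/card_gt0P; exists y.
have b_gt0 : (0 < hits H)%N by rewrite muln_gt0 SH_gt0 expn_gt0 cardG_gt0.
have le_w y : y \in Sigma :&: H -> (weight y <= (hits H)%:R^-1)%R.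
  move=> SHy; case: (boolP (H \in Ms)) => [MsH|nMsH]; first by rewrite (weight_in MsH).
  by apply: weight_le => // M MsM; apply: le_other.
have le_wt : (wt weight (Sigma :&: H) <= #|Sigma :&: H|%:R * (hits H)%:R^-1)%R.
  by rewrite mulr_natl -sumr_const; apply: ler_sum.
apply: le_trans (ler_wpM2r (ler0n _ _) le_wt) _.
by rewrite mulrAC -natrM divff // pnatr_eq0 -lt0n.
Qed.

Lemma wt_total : (wt weight S * (#|S| ^ m.-1)%:R =
  (\sum_(M in Ms) #|S : M| ^ m.-1)%:R)%R.
Proof.
rewrite /wt /weight (exchange_big_dep (mem Ms)) /=; last by move=> y M _ /andP[].
rewrite mulr_suml natr_sum; apply: eq_bigr => M MsM.
have sMS : M \subset S by have/maxgroupp/andP[] := Ms_max MsM.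
transitivity (\sum_(y in Sigma :&: M) (hits M)%:R^-1 * (#|S| ^ m.-1)%:R : rat)%R.
  rewrite mulr_suml; apply: eq_bigl => y; rewrite MsM inE.
  by case: (boolP (y \in Sigma)) => [/(subsetP Sigma_sub)->|] //=; rewrite andbF.
rewrite -mulr_suml sumr_const -mulr_natl -(Lagrange sMS) expnMn !natrM.
rewrite invfM mulrA; field.
have := meetM MsM; rewrite -card_gt0 => ?.
by rewrite !pnatr_eq0 -!lt0n expn_gt0 cardG_gt0.
Qed.

Let c : rat := ((((1 + alpha m) * #|S| ^ (m %/ pdiv m))%N%:R)^-1)%R.

Lemma weight_le_c y : (weight y <= c)%R.
Proof. by apply: weight_le; rewrite ?muln_gt0 ?expn_gt0 ?cardG_gt0. Qed.

Lemma diag_small e : (e <= #|S| ^ (m %/ pdiv m))%N -> (2%:R * c * e%:R <= 1)%R.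
Proof.
move=> le_e; rewrite mulrAC /c ler_pdivrMr ?ltr0n ?muln_gt0 ?expn_gt0 ?cardG_gt0 //.
by rewrite mul1r -natrM ler_nat leq_mul // add1n ltnS alpha_gt0.
Qed.

Local Notation W := (wreath_type gT m).
Variable C : {set {group W}}.
Hypothesis covC : is_covering (wreath m S) C.

Lemma covering_proper K : K \in C -> K \proper wreath m S.
Proof. by have /andP[/forall_inP prC _] := covC; apply: prC. Qed.

Lemma covering_sub K : K \in C -> K \subset wreath m S.
Proof. by case/covering_proper/andP. Qed.

Lemma coveringP g : g \in wreath m S -> exists2 K, K \in C & g \in K.
Proof. by have /andP[_ /eqP<-] := covC; move/bigcupP. Qed.

Let m_gt0 : (0 < m)%N := ltnW m_ge2.
Let o0 : 'I_m := Ordinal m_gt0.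
Let o1 : 'I_m := Ordinal m_ge2.

(* Q collects the full members that lie in boxes, and D the diagonal ones. *)
Let Full := [set K in C | full K].
Let Q := [set K in Full | base_proj K [::] o0 != S].
Let D := Full :\: Q.
Let H (K : {group W}) : {group gT} := base_proj_group K [::] o1.

Lemma FullP K : K \in Full -> [/\ K \in C, K \subset wreath m S & full K].
Proof. by rewrite inE => /andP[CK fK]; split; rewrite ?covering_sub. Qed.

Lemma Q_sub K : K \in Q -> K \in Full. Proof. by rewrite inE => /andP[]. Qed.

Lemma base_proj_proper K i : K \in Q -> base_proj K [::] i \proper S.
Proof.
case/setIdP=> /FullP[CK sKW fK] neS.
rewrite properEcard base_proj_sub //= (card_base_proj fK i o0).
by apply: proper_card; rewrite properEneq neS base_proj_sub.
Qed.

Lemma card_base_D K : K \in D -> (#|base_vanish K [::]| <= #|S| ^ (m %/ pdiv m))%N.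
Proof.
rewrite inE => /andP[nQ FK]; have [CK sKW fK] := FullP FK.
apply: card_base_diagonal => //; last exact: covering_proper.
move=> i; apply/eqP; rewrite eqEcard base_proj_sub //= (card_base_proj fK i o0).
by move: nQ; rewrite inE FK negbK => /eqP->.
Qed.

Lemma chart_cover j : (0 < j)%N -> j %| m ->
    (forall K, K \in C -> top_fibre K j != set0 -> full K) ->
  boxset (fun=> S) \subset (\bigcup_(K in Q) boxset (coset_box K j)) :|:
     \bigcup_(K in D) (chart j @: top_fibre K j).
Proof.
move=> j_gt0 dvd_jm fullC; apply/subsetP=> u /(chart_onto j_gt0 dvd_jm)[g [Wg tg <-]].
have [K CK Kg] := coveringP Wg.
have Fg : g \in top_fibre K j by rewrite inE Kg tg /=.
have FK : K \in Full by rewrite inE CK fullC //; apply/set0Pn; exists g.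
rewrite inE; case: (boolP (K \in Q)) => QK; apply/orP; [left | right].
  apply/bigcupP; exists K => //; apply/boxsetP=> i.
  by apply: chart_in_coset_box.
apply/bigcupP; exists K; first by rewrite inE QK.
exact: imset_f.
Qed.

Lemma card_chart_diag j K : K \in D ->
  (#|chart j @: top_fibre K j| <= #|S| ^ (m %/ pdiv m))%N.
Proof.
move=> DK; apply: leq_trans (leq_imset_card _ _) _.
have [_ _ fK] : [/\ K \in C, K \subset wreath m S & full K].
  by apply: FullP; case/setDP: DK.
by rewrite card_top_fibre // card_base_D.
Qed.

Lemma card_Full : (#|Full| = #|Q| + #|D|)%N.
Proof.
rewrite -(cardsID Q Full); congr (_ + _)%N; apply: eq_card => K.
by rewrite inE; case: (boolP (K \in Q)) => [/Q_sub->|]; rewrite ?andbF.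
Qed.

Local Notation n := (\sum_(M in Ms) #|S : M| ^ m.-1)%N.

Lemma card_full_ge : (n <= #|Full|)%N.
Proof.
have fullC K : K \in C -> top_fibre K 1 != set0 -> full K.
  move=> CK /set0Pn[g]; rewrite inE expg1 => /andP[Kg tg].
  by apply/exists_inP; exists g.
have cov1 := chart_cover (ltn0Sn 0) (dvd1n m) fullC.
rewrite -(ler_nat rat) -wt_total.
apply: (covering_weight_le weight_ge0 (o := o0)
  (E := fun K => if K \in Q then boxset (coset_box K 1) else chart 1 @: top_fibre K 1)).
  apply: subset_trans cov1 _; apply/subsetP=> u /setUP[]/bigcupP[K].
    by move=> QK uK; apply/bigcupP; exists K; rewrite ?QK ?Q_sub.
  by move=> /setDP[FK /negPf QK] uK; apply/bigcupP; exists K; rewrite ?QK.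
move=> K FK; case: ifP => QK.
  have [CK sKW fK] := FullP FK.
  rewrite (wt_boxset_const _ _ (h := #|base_proj K [::] o0|)) => [|i].
    exact/(weight_subgroup (H := base_proj_group K [::] o0))/base_proj_proper.
  exact: card_coset_box.
have DK : K \in D by rewrite inE QK.
apply: (@le_trans _ _ (\sum_(u in chart 1 @: top_fibre K 1) c)%R).
  by apply: ler_sum => u _; apply: weight_le_c.
rewrite sumr_const -mulr_natr; apply: le_trans (diag_small (card_chart_diag 1 DK)).
rewrite ler_wpM2r // ler_peMl ?ler1n //.
exact: le_trans (weight_ge0 1) (weight_le_c 1).
Qed.

Lemma total_ge : (2 ^ m.-1 <= n)%N.
Proof.
have /set0Pn[M MsM] := Ms_n0; rewrite (bigD1 M) //=; apply: leq_trans (leq_addr _ _).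
have/maxgroupp/andP[sMS nSM] := Ms_max MsM.
by case: (m.-1) => // k; rewrite leq_exp2r // indexg_gt1.
Qed.

(** The lines in the direction of coordinate 1 are available because 1 < r: the
    coordinate then belongs to a cycle other than that of 0, and its sides are
    subgroups.  More than 2 n full members are enough anyway, as
    n >= 2^(m-1). *)
Lemma card_full_ge_prime r : prime r -> r %| m ->
    (forall K, K \in C -> top_fibre K r != set0 -> full K) ->
  (n + alpha m <= #|Full|)%N.
Proof.
move=> pr_r dvd_rm fullC; have ge_n := total_ge; have a_le := alpha_bound m_ge2.
have [big_F|small_F] := leqP (2 * n) #|Full|.
  by apply: leq_trans big_F; rewrite mul2n -addnn leq_add2l; lia.
have covr := chart_cover (prime_gt0 pr_r) dvd_rm fullC.
have ne_o1 : o1 != o0 by [].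
suff: (n%:R + (2 ^ m.-1)%:R / 5%:R <= #|Q|%:R + #|D|%:R :> rat)%R.
  rewrite -natrD -card_Full; move: a_le.
  move: #|Full| (alpha m) n (2 ^ m.-1)%N => F a N t.
  rewrite -(ltr_nat rat) natrM natrD => a_le le_F; rewrite -ltnS -(ltr_nat rat).
  by rewrite -addn1 !natrD; lra.
apply: tangent_optimum => [|||lam].
- by rewrite ltr0n expn_gt0.
- by rewrite ler_nat.
- rewrite -natrM ler_nat; apply: leq_trans (ltnW small_F).
  by rewrite card_Full leq_addr.
have -> : ((2 ^ m.-1)%:R / 2%:R = (2 ^ m.-2)%:R :> rat)%R.
  have -> : m.-1 = m.-2.+1 by rewrite prednK // -ltnS prednK.
  by rewrite expnS natrM mulrC mulKf.
rewrite -wt_total.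
apply: (lines_bound weight_ge0 ne_o1 m_ge2 covr (H := H)) => [K|K|K|K i|K|y|K].
- exact: base_proj_proper.
- by move=> _; rewrite /coset_box /= prime_gt1.
- by move=> QK; rewrite /coset_box /= prime_gt0 //; apply/proper_sub/base_proj_proper.
- by move=> /Q_sub/FullP[_ _ fK]; apply: card_coset_box.
- move=> QK; rewrite /coset_box /= prime_gt0 //; have /FullP[_ _ fK] := Q_sub QK.
  rewrite [#|H K|](card_base_proj fK o1 o0).
  exact/(weight_subgroup (H := base_proj_group K [::] o0))/base_proj_proper.
- exact: weight_le_c.
move=> DK; apply: diag_small; exact: card_chart_diag.
Qed.

(** Each prime r for which a nonfull member of C reaches the r-th power of the
    rotation provides its own member, by [top_fibre_coprime]. *)
Lemma covering_lower_bound : (alpha m + n <= #|C|)%N.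
Proof.
have leFC : Full \subset C by apply/subsetP=> K /FullP[].
case: (boolP [exists r : 'I_m.+1, [&& prime r, r %| m &
    [forall K in C, (top_fibre K r != set0) ==> full K]]]).
  case/existsP=> r /and3P[pr_r dvd_rm /forall_inP fullC].
  rewrite addnC; apply: leq_trans (subset_leq_card leFC).
  by apply: (card_full_ge_prime pr_r dvd_rm) => K CK; apply/implyP/fullC.
rewrite negb_exists => /forallP none.
pose nf r : {group W} :=
  odflt 1%G [pick K in C | (top_fibre K r != set0) && ~~ full K].
have nfP r : r \in primes m ->
    [/\ prime r, nf r \in C, top_fibre (nf r) r != set0 & ~~ full (nf r)].
  rewrite mem_primes => /and3P[pr_r _ dvd_rm].
  have lt_r : (r < m.+1)%N by rewrite ltnS dvdn_leq.
  have := none (Ordinal lt_r); rewrite /= pr_r dvd_rm /= negb_forall_in.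
  case/exists_inP=> K CK; rewrite negb_imply => nK.
  rewrite /nf; case: pickP => [L /and3P[CL FL nL]|/(_ K)]; first by split.
  by rewrite /= CK nK.
pose s := [seq nf r | r <- primes m].
have us : uniq s.
  rewrite map_inj_in_uniq ?primes_uniq // => r q.
  move=> /nfP[pr_r _ Fr nfull] /nfP[pr_q _ Fq _] eq_rq.
  apply: contraNeq nfull => ne_rq; rewrite -eq_rq in Fq.
  apply: top_fibre_coprime (prime_gt0 pr_r) _ Fr Fq.
  by rewrite prime_coprime // dvdn_prime2.
have ss : {subset s <= C :\: Full}.
  by move=> _ /mapP[r /nfP[_ CK _ nF] ->]; rewrite !inE CK nF.
rewrite -(cardsID Full C) addnC (setIidPr leFC) leq_add ?card_full_ge //.
rewrite /alpha -(size_map nf) cardE.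
by apply: uniq_leq_size us _ => K /ss; rewrite mem_enum.
Qed.

End Lower.

Theorem theorem1p1 (gT : finGroupType) (S : {group gT})
    (Sigma : {set gT}) (m : nat) (Ms : {set {group gT}})
    (S_simple : simple S) (S_nonabelian : ~~ abelian S)
    (Sigma_sub : Sigma \subset S) (Sigma_n0 : Sigma != set0)
    (m_gt0 : (0 < m)%N)
    (Ms_n0 : Ms != set0)
    (Ms_max : forall M : {group gT}, M \in Ms -> maximal M S)
    (h0 : forall (M : {group gT}) (s : gT),
        M \in Ms -> s \in S -> (M :^ s)%G \in Ms)
    (h1 : forall M : {group gT}, M \in Ms -> Sigma :&: M != set0)
    (h2 : Sigma \subset \bigcup_(M in Ms) M)
    (h3 : forall M1 M2 : {group gT}, M1 \in Ms -> M2 \in Ms -> M1 != M2 ->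
        Sigma :&: M1 :&: M2 = set0)
    (h4 : exists M1 M2 : {group gT},
        [/\ M1 \in Ms, M2 \in Ms & gval M2 \notin M1 :^: S])
    (m_ge2 : (2 <= m)%N)
    (h5 : (maxn ((1 + alpha m) * #|S| ^ (m %/ pdiv m))
                (\max_(H : {group gT} | (H \proper S) && (H \notin Ms))
                    #|Sigma :&: H| * #|H| ^ m.-1)
           <= minn ((\sum_(M1 in Ms) \sum_(M2 in Ms | gval M2 \notin M1 :^: S)
                        #|Sigma :&: M1| * #|Sigma :&: M2|) * #|S| ^ (m - 2))
                   (min_over (fun M : {group gT} => M \in Ms)
                      (fun M : {group gT} => #|Sigma :&: M| * #|M| ^ m.-1)))%N) :
  (alpha m + \sum_(M in Ms) #|S : M| ^ m.-1 <= sigma (wreath m S)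
   /\ sigma (wreath m S)
      <= alpha m + min_over (is_covering S)
           (fun N : {set {group gT}} => \sum_(M in N) #|S : M| ^ m.-1))%N.
Proof.
have le_min M : M \in Ms -> (maxn ((1 + alpha m) * #|S| ^ (m %/ pdiv m))
      (\max_(H : {group gT} | (H \proper S) && (H \notin Ms))
         #|Sigma :&: H| * #|H| ^ m.-1) <= #|Sigma :&: M| * #|M| ^ m.-1)%N.
  move=> MsM; apply: leq_trans h5 _; apply: leq_trans (geq_minr _ _) _.
  exact: (@min_over_le _ (fun M : {group gT} => M \in Ms)).
have le_diag M : M \in Ms ->
    ((1 + alpha m) * #|S| ^ (m %/ pdiv m) <= #|Sigma :&: M| * #|M| ^ m.-1)%N.
  by move/le_min; apply: leq_trans; apply: leq_maxl.
have le_other (H M : {group gT}) : H \proper S -> H \notin Ms -> M \in Ms ->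
    (#|Sigma :&: H| * #|H| ^ m.-1 <= #|Sigma :&: M| * #|M| ^ m.-1)%N.
  move=> prH nMsH /le_min; apply: leq_trans; apply: leq_trans (leq_maxr _ _).
  pose F (L : {group gT}) := (#|Sigma :&: L| * #|L| ^ m.-1)%N.
  by apply: (@leq_bigmax_cond _ _ F); rewrite prH.
have [N0 covN0] := nonabelian_has_covering S_nonabelian.
have [N covN ->] := min_over_attained
  (fun N : {set {group gT}} => \sum_(M in N) #|S : M| ^ m.-1)%N covN0.
have covW := wreath_coverP m_ge2 covN.
split=> /=; last first.
  apply: leq_trans _ (card_wreath_cover S m_ge2 N).
  exact: (min_over_le (fun C : {set {group _}} => #|C|)).
rewrite /sigma.
have [C covC ->] := min_over_attained (fun C : {set {group _}} => #|C|) covW.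
exact: (@covering_lower_bound _ S Sigma).
Qed.
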